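(* Let $n\geq 3$, let $B\in\mathcal{S}^n$ and suppose that $\operatorname{dist}(B,[-1,1]^n)>1$ (equivalently, $m_B<n$). Let $\mathcal{I}^n\bigl(\tfrac{1}{n+1}\bigr)$ be the recursively constructed set $\mathcal{I}^n(\delta)$ defined in the context, with $\delta=\tfrac{1}{n+1}$. Then there is a (sufficiently small) $\eta>0$, depending only on $n$ and on the value of $\operatorname{dist}(B,[-1,1]^n)-1$, such that the set $$\Bigl[\mathcal{I}^n\bigl(\tfrac{1}{n+1}\bigr)\setminus\Bigl\{\pm\bigl(1,\tfrac{1}{n+1},\tfrac1{n+1},\ldots,\tfrac{1}{n+1},\tfrac{1}{n+1}\bigr),\ \pm\bigl(\tfrac{1}{n+1},\ldots,\tfrac{1}{n+1},-\tfrac{1}{n+1},1\bigr)\Bigr\}\Bigr]\ \cup\ \Bigl\{\pm\bigl(1,\tfrac{1}{n+1},\ldots,\tfrac{1}{n+1},\eta,\tfrac{1}{n+1}\bigr)\Bigr\}$$ illuminates $B$. Here, in the second removed pair, the entries $-\tfrac1{n+1}$ and $1$ are the $(n-1)$-th and $n$-th coordinates and all other coordinates equal $\tfrac1{n+1}$ (up to the global sign $\pm$); in the added pair the first coordinate is $1$, the $(n-1)$-th coordinate is $\eta$ and all other coordinates are $\tfrac{1}{n+1}$ (up to the global sign $\pm$). Consequently $\mathfrak{I}(B)\leq 2^n-2$.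
   Context: A convex body in $\mathbb{R}^n$ is a compact convex set with non-empty interior. A convex body $B\subset\mathbb{R}^n$ is 1-symmetric if $(x_1,\ldots,x_n)\in B$ implies $(\epsilon_1x_{\sigma(1)},\ldots,\epsilon_nx_{\sigma(n)})\in B$ for all signs $\epsilon_i\in\{\pm1\}$ and all permutations $\sigma$ of $[n]=\{1,\ldots,n\}$. $\mathcal{S}^n$ denotes the class of 1-symmetric convex bodies $B\subset\mathbb{R}^n$ with $e_i\in\partial B$ for all $i\in[n]$ (equivalently $\|e_i\|_B=1$, where $\|x\|_B=\inf\{t>0:x\in tB\}$); every $B\in\mathcal{S}^n$ satisfies $B\subseteq[-1,1]^n$. For $B\in\mathcal{S}^n$, $\operatorname{dist}(B,[-1,1]^n)=\inf\{\alpha\geq1:[-1,1]^n\subseteq\alpha B\}$ and $m_B=\max\{k\in[n]:e_1+\cdots+e_k\in B\}$. A direction is a non-zero vector of $\mathbb{R}^n$. A direction $d$ illuminates a boundary point $x$ of a convex body $K$ if there is $\varepsilon>0$ with $x+\varepsilon d\in\operatorname{int}K$; a set of directions illuminates $K$ if every boundary point of $K$ is illuminated by at least one of its elements; $\mathfrak{I}(K)$ is the smallest cardinality of a set of directions illuminating $K$. Recursive construction: for $\delta\in(0,1)$ put $\mathcal{I}^2(\delta)=\{\pm(1,\delta),\ \pm(\delta,-1)\}$, and for $n\geq3$ $$\mathcal{I}^n(\delta)=\bigl\{(d,\ \operatorname{sign}(d_{n-1})\delta): d\in\mathcal{I}^{n-1}(\delta)\bigr\}\cup\bigl\{(\delta\operatorname{sign}(d_1),\ldots,\delta\operatorname{sign}(d_{n-1}),\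 -\operatorname{sign}(d_{n-1})): d\in\mathcal{I}^{n-1}(\delta)\bigr\}.$$ This is a set of $2^n$ directions, closed under $d\mapsto -d$. *)

(* Defs.v *)
(* MathComp / MathComp-Analysis.  R^n is the type 'rV[R]_n of row vectors over
   R : realType with its product topology; the k-th coordinate (k = 1, ..., n)
   of x is x 0 i for the i : 'I_n of value k - 1. *)
From HB Require Import structures.
From mathcomp Require Import all_boot all_order all_algebra all_fingroup.
From mathcomp Require Import all_classical all_reals all_analysis.

Import Order.TTheory GRing.Theory Num.Theory.
Import numFieldNormedType.Exports.

Local Open Scope classical_set_scope.
Local Open Scope ring_scope.

Section Bodies.
Context {R : realType} {n : nat}.
Implicit Types (B D K : set 'rV[R]_n) (d x : 'rV[R]_n).

Definition boundary K : set 'rV[R]_n := closure K `\` interior K.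

Definition convex_body K : Prop :=
  [/\ compact K, convex_set K & interior K !=set0].

(* sgn i = true encodes the sign -1. *)
Definition one_symmetric B : Prop :=
  forall (sgn : 'I_n -> bool) (s : 'S_n) x,
    B x -> B (\row_i ((-1) ^+ sgn i * x 0 (s i))).

Definition sym_class B : Prop :=
  [/\ convex_body B, one_symmetric B
    & forall i : 'I_n, boundary B (delta_mx 0 i)].

Definition cube : set 'rV[R]_n := [set x | forall i, -1 <= x 0 i <= 1].

Definition cube_dist B : R :=
  inf [set alpha | 1 <= alpha /\ cube `<=` [set alpha *: x | x in B]].

Definition m_index B : nat :=
  (\max_(1 <= k < n.+1
     | `[< B (\sum_(i < n | (i < k)%N) delta_mx 0 i)%R >]) k)%N.

Definition illuminates_point d K x : Prop :=
  exists2 eps : R, 0 < eps & interior K (x + eps *: d).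

Definition illuminates D K : Prop :=
  (forall d, D d -> d != 0) /\
  (forall x, boundary K x -> exists2 d, D d & illuminates_point d K x).

(* Extended-real valued: an infinite set D has counting D = +oo, and the
   infimum is +oo if no set of directions illuminates K. *)
Definition illumination_number K : \bar R :=
  ereal_inf [set counting D | D in [set D | illuminates D K]].

End Bodies.

Section Directions.
Context {R : realType}.
Implicit Types (delta eta : R).

(* (d_1, ..., d_n, a) *)
Definition row_rcons {n} (d : 'rV[R]_n) (a : R) : 'rV[R]_n.+1 :=
  \row_i oapp (d 0) a (unlift ord_max i).

Definition row2 (a b : R) : 'rV[R]_2 := \row_i (if i == ord0 then a else b).

Fixpoint rec_dirs_from2 delta m : set 'rV[R]_m.+2 :=
  match m with
  | 0 => [set row2 1 delta; - row2 1 delta; row2 delta (-1); - row2 delta (-1)]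
  | p.+1 =>
      [set row_rcons d (Num.sg (d 0 ord_max) * delta)
         | d in rec_dirs_from2 delta p] `|`
      [set row_rcons (\row_j (delta * Num.sg (d 0 j))) (- Num.sg (d 0 ord_max))
         | d in rec_dirs_from2 delta p]
  end.

(* The set I^n(delta), meaningful for n >= 2 only. *)
Definition rec_dirs delta n : set 'rV[R]_n :=
  match n with
  | m.+2 => rec_dirs_from2 delta m
  | _ => set0
  end.

(* (1, delta, ..., delta) *)
Definition row_head1 delta n : 'rV[R]_n :=
  \row_(i < n) (if i == 0%N :> nat then 1 else delta).

(* (delta, ..., delta, -delta, 1) *)
Definition row_last1 delta n : 'rV[R]_n :=
  \row_(i < n) (if i == n.-1 :> nat then 1
                else if i == n.-2 :> nat then - delta else delta).

(* (1, delta, ..., delta, eta, delta) *)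
Definition row_mod delta eta n : 'rV[R]_n :=
  \row_(i < n) (if i == 0%N :> nat then 1
                else if i == n.-2 :> nat then eta else delta).

Definition modified_dirs delta eta n : set 'rV[R]_n :=
  (rec_dirs delta n `\`
     [set row_head1 delta n; - row_head1 delta n;
          row_last1 delta n; - row_last1 delta n])
  `|` [set row_mod delta eta n; - row_mod delta eta n].

End Directions.

(* Main.v *)
Require Import Defs.
From HB Require Import structures.
From mathcomp Require Import all_boot all_order all_algebra all_fingroup.
From mathcomp Require Import all_classical all_reals all_analysis.
From mathcomp Require Import ring lra.
Import Order.TTheory GRing.Theory Num.Theory.
Import numFieldNormedType.Exports.
Local Open Scope classical_set_scope.
Local Open Scope ring_scope.

(** The recursion produces exactly one direction for each sign pattern
    [s] in {+,-}^n: its entries have the signs of [s], the entry at the last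
    sign change of [s] (or the first entry, if [s] is constant) has modulus 1,
    and all others have modulus delta ([rec_dirsE]).

    A 1-symmetric body is unconditional, and it is closed under moving mass
    from a large coordinate to a smaller one (average a point with its image
    under the transposition of the two coordinates).  Hence a direction whose
    dominant entry strictly decreases a coordinate of [x] of maximal modulus,
    and which decreases all the other coordinates of maximal modulus,
    illuminates [x]: the coordinates that it may increase are not maximal, and
    since n delta < 1 the loss in the dominant coordinate pays for all of these
    increases ([illuminates_swap]).

    So only the set [T] of coordinates of maximal modulus and the signs of [x]
    on [T] matter.  Let [k] be the least element of [T] such that all entries
    of [x] at positions of [T] from [k] on have the same sign.  Opposing the
    signs of [x] on [T], and completing the pattern outside [T] by the sign
    opposite to that of position [k] before [k] and equal to it after [k],
    gives a pattern whose last sign change is at [k] ([pattern_choice]).  The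
    corresponding direction is missing from the modified set in two situations
    only.  If [k] is the first coordinate then [x] has constant sign on [T] and
    the new direction +-(1, delta, ..., eta, delta) does the work.  Otherwise
    [T] contains all coordinates and, up to a global sign, [x] opposes
    (+, ..., +, -, +).

    In this last situation [x] is, up to signs, M (1, ..., 1), and
    dist(B, [-1,1]^n) <= 1/M, so M < 1.  The new direction decreases all
    moduli except that of the penultimate coordinate, which grows at rate eta
    only; comparing with the segment from [x] to the unit vector of that
    coordinate, which exists because M < 1, shows that [x] is illuminated as
    soon as M eta < (1 - M) delta ([illuminates_equal_moduli]).  This is
    guaranteed by eta < delta (dist - 1).

    Finally, the modified directions are parametrized by the sign patterns
    other than +-(+, ..., +, -, +), the two constant patterns standing for the
    two new directions; this leaves at most 2^n - 2 of them. *)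

(** * 1-symmetric bodies *)

Lemma ex_pos_lower_bound {R : realFieldType} {I : finType} (P : pred I)
    (g : I -> R) :
  (forall i, P i -> 0 < g i) -> exists2 e, 0 < e & forall i, P i -> e <= g i.
Proof.
move=> g0; exists (\big[Num.min/1]_(i | P i) g i).
  by apply: lt_bigmin.
by move=> i Pi; apply: bigmin_le_cond.
Qed.

Lemma mulr_lt0_opposite {R : realDomainType} (a b : R) :
  a != 0 -> b != 0 -> (b < 0) = (0 < a) -> a * b < 0.
Proof.
move=> a0 b0; case: (ltgtP a 0) a0 => // a0 _.
  by move=> /negbT; rewrite -leNgt le_eqVlt eq_sym (negbTE b0) /= nmulr_rlt0.
by rewrite pmulr_rlt0.
Qed.

Lemma convex_set_comb {R : realType} {n : nat} {B : set 'rV[R]_n} {a : R}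
    {x y : 'rV[R]_n} :
  convex_set B -> 0 <= a <= 1 -> B x -> B y -> B (a *: x + (1 - a) *: y).
Proof.
move=> cB /andP[a0 a1] Bx By.
have ai : Itv.spec (Itv.num_sem (R:=R)) (Itv.Real `[0%Z, 1%Z]) a.
  by rewrite /= /Itv.num_sem /= ?num_real ?in_itv /= ?a0 ?a1.
by have := cB x y (Itv.mk ai); rewrite !inE; apply.
Qed.

Section Symmetric.
Set Implicit Arguments.
Unset Strict Implicit.
Context {R : realType} {n : nat}.
Implicit Types (B : set 'rV[R]_n) (d x y z u : 'rV[R]_n).

Lemma sym_class_closed B : sym_class B -> closure B `<=` B.
Proof.
case=> -[cB _ _] _ _ x; apply: compact_closed cB _.
exact: norm_hausdorff.
Qed.

Lemma sym_class_unit B i : sym_class B -> B (delta_mx 0 i).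
Proof.
by move=> SB; case: (SB) => _ _ /(_ i)[+ _]; exact: sym_class_closed.
Qed.

(** A coordinate [y_k] is replaced by any value [z_k] of smaller modulus by a
    convex combination of the point and its reflection in the [k]-th
    coordinate hyperplane; this is done one coordinate at a time. *)
Lemma sym_class_unconditional B y z : sym_class B ->
  B y -> (forall i, `|z 0 i| <= `|y 0 i|) -> B z.
Proof.
move=> [[_ cB _] SB _] By zy.
suff H (r : seq 'I_n) : B (\row_i if i \in r then z 0 i else y 0 i).
  rewrite (_ : z = \row_i if i \in enum 'I_n then z 0 i else y 0 i)//.
  by apply/rowP => i; rewrite mxE mem_enum.
elim: r => [|k r IH].
  by rewrite (_ : \row_i _ = y)//; apply/rowP => i; rewrite mxE.
set u := \row_i _ in IH.
have [kr|kr] := boolP (k \in r).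
  rewrite (_ : \row_i _ = u)//; apply/rowP => i; rewrite !mxE in_cons.
  by have [->|//] := eqVneq i k; rewrite kr.
have [yk0|yk0] := eqVneq (y 0 k) 0.
  rewrite (_ : \row_i _ = u)//; apply/rowP => i; rewrite !mxE in_cons.
  have [->|//] := eqVneq i k; rewrite (negbTE kr) yk0 /=; apply/eqP.
  by rewrite -normr_le0 (le_trans (zy k)) ?yk0 ?normr0.
have Bv := SB (fun i => i == k) 1%g _ IH.
(* The weight solves a y_k - (1 - a) y_k = z_k. *)
pose a := (1 + z 0 k / y 0 k) / 2.
have zyk : `|z 0 k / y 0 k| <= 1.
  by rewrite normrM normfV ler_pdivrMr ?normr_gt0// mul1r.
have a01 : 0 <= a <= 1.
  by move: zyk; rewrite ler_norml /a => /andP[? ?]; apply/andP; split; lra.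
have := convex_set_comb cB a01 IH Bv; congr (B _).
apply/rowP => i; rewrite !mxE perm1 in_cons.
have [->|ik] /= := eqVneq i k.
  by rewrite (negbTE kr) expr1 /a; field.
by rewrite expr0 mul1r -mulrDl addrC subrK mul1r.
Qed.

Lemma sym_class_interior B y z : sym_class B ->
  B y -> (forall i, `|z 0 i| < `|y 0 i|) -> interior B z.
Proof.
move=> SB By zy.
have [|e e0 eP] := ex_pos_lower_bound xpredT (fun i => `|y 0 i| - `|z 0 i|).
  by move=> i _; rewrite subr_gt0.
rewrite /interior; apply/nbhs_ballP; exists e => //= w [_ zw].
apply: sym_class_unconditional SB By _ => i.
have := zw 0 i; rewrite /ball /= => zwi; have := eP i isT.
have := ler_normB (z 0 i) (z 0 i - w 0 i); rewrite subKr.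
by move: zwi; lra.
Qed.

(** The hypothesis compares, coordinate by coordinate, what a step [mu] in the
    direction [d] does to the moduli (the first alternative is for coordinates
    that [d] decreases) with what moving from |x| to [y] does.  By convexity
    the comparison can be scaled down to a step [eps]: the point reached is
    then strictly dominated by the point at ratio [eps / mu] of the segment
    from |x| to [y], which lies in [B]. *)
Lemma illuminates_toward B x y d (mu : R) : sym_class B ->
  B x -> B y -> 0 < mu ->
  (forall i, x 0 i * d 0 i < 0 /\ `|x 0 i| - mu * `|d 0 i| < y 0 i \/
             `|x 0 i| + mu * `|d 0 i| < y 0 i) ->
  illuminates_point d B x.
Proof.
move=> SB Bx By mu0 H.
(* Steps up to this bound do not change the sign of a decreasing coordinate. *)
have [|e e0 eP] := ex_pos_lower_bound (fun i => x 0 i * d 0 i < 0)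
    (fun i => `|x 0 i| / `|d 0 i|).
  move=> i xd; rewrite divr_gt0 ?normr_gt0//.
    by apply: contraTneq xd => ->; rewrite mul0r ltxx.
  by apply: contraTneq xd => ->; rewrite mulr0 ltxx.
pose eps := Num.min e mu.
have eps0 : 0 < eps by rewrite lt_min e0.
have eps_e : eps <= e by rewrite ge_min lexx.
have eps_mu : eps <= mu by rewrite ge_min lexx orbT.
exists eps => //.
pose a := eps / mu.
have a0 : 0 < a by rewrite divr_gt0.
have a01 : 0 <= a <= 1 by rewrite ltW// ler_pdivrMr// mul1r.
have epsE : eps = a * mu by rewrite divfK// gt_eqF.
have Bx' : B (\row_i `|x 0 i|).
  by apply: sym_class_unconditional SB Bx _ => i; rewrite mxE normr_id.
case: (SB) => -[_ cB _] _ _.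
apply: sym_class_interior SB (convex_set_comb cB a01 By Bx') _ => i.
rewrite !mxE; apply: lt_le_trans (ler_norm _).
have [[xd Hi]|Hi] := H i; last first.
  apply: (le_lt_trans (ler_normD _ _)).
  rewrite normrM (gtr0_norm eps0) epsE.
  have := ltr_pM2l a0; move=> /(_ (`|x 0 i| + mu * `|d 0 i|) (y 0 i)).
  by rewrite Hi mulrDr; lra.
have -> : `|x 0 i + eps * d 0 i| = `|x 0 i| - eps * `|d 0 i|.
  have {}eP : eps * `|d 0 i| <= `|x 0 i|.
    rewrite -ler_pdivlMr; first exact: le_trans (eP i xd).
    by rewrite normr_gt0; apply: contraTneq xd => ->; rewrite mulr0 ltxx.
  move: xd eP; have [x0|x0|->] := ltgtP (x 0 i) 0; last by rewrite mul0r ltxx.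
    rewrite nmulr_rlt0// (ltr0_norm x0) => d0; rewrite gtr0_norm// => ?.
    by rewrite ler0_norm; lra.
  rewrite pmulr_rlt0// (gtr0_norm x0) => d0; rewrite ltr0_norm// => ?.
  by rewrite ger0_norm; lra.
rewrite epsE.
have := ltr_pM2l a0; move=> /(_ (`|x 0 i| - mu * `|d 0 i|) (y 0 i)).
by rewrite Hi mulrBr; lra.
Qed.

(** A Robin Hood transfer: the result is a convex combination of [u] and of its
    image under the transposition of the coordinates [i] and [k]. *)
Lemma sym_class_transfer B u (k i : 'I_n) (tau : R) :
  sym_class B -> B u -> i != k -> 0 <= tau -> u 0 i + tau <= u 0 k ->
  B (\row_j if j == k then u 0 k - tau else
            if j == i then u 0 i + tau else u 0 j).
Proof.
move=> [[_ cB _] SB _] Bu ik tau0 uik.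
have [->|tauN0] := eqVneq tau 0.
  rewrite (_ : \row_j _ = u)//; apply/rowP => j; rewrite mxE subr0 addr0.
  by case: eqVneq => [->//|_]; case: eqVneq => [->|].
have gap0 : 0 < u 0 k - u 0 i by rewrite subr_gt0; lra.
have gapN0 : u 0 k - u 0 i != 0 by rewrite gt_eqF.
have Bv := SB (fun=> false) (tperm i k) _ Bu.
pose a := tau / (u 0 k - u 0 i).
have a01 : 0 <= a <= 1.
  by rewrite divr_ge0 ?(ltW gap0)//= ler_pdivrMr// mul1r; lra.
have := convex_set_comb cB a01 Bv Bu; congr (B _).
apply/rowP => j; rewrite !mxE expr0 mul1r.
case: (eqVneq j k) => [->|jk]; first by rewrite tpermR /a; field.
case: (eqVneq j i) => [->|ji]; first by rewrite tpermL /a; field.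
by rewrite tpermD 1?eq_sym// -mulrDl addrC subrK mul1r.
Qed.

(** The gap [n tau] leaves coordinate [k] large enough for each of the
    successive transfers. *)
Lemma sym_class_spread B u (k : 'I_n) (A : {set 'I_n}) (tau : R) :
  sym_class B -> B u -> k \notin A -> 0 <= tau ->
  (forall i, i \in A -> u 0 i + n%:R * tau <= u 0 k) ->
  B (\row_j if j == k then u 0 k - #|A|%:R * tau else
            if j \in A then u 0 j + tau else u 0 j).
Proof.
move=> SB Bu kA tau0 gap.
suff H (r : seq 'I_n) : uniq r -> {subset r <= A} ->
    B (\row_j if j == k then u 0 k - (size r)%:R * tau else
               if j \in r then u 0 j + tau else u 0 j).
  have /(H _ (enum_uniq A)) : {subset enum A <= A}.
    by move=> i; rewrite mem_enum.
  rewrite -cardE.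
  by congr (B _); apply/rowP => j; rewrite !mxE mem_enum.
elim: r => [_ _|i r IH /= /andP[ir ur] rA].
  rewrite (_ : \row_j _ = u)//; apply/rowP => j; rewrite mxE mul0r subr0.
  by case: eqVneq => [->|].
have {}IH := IH ur (fun j jr => rA j (mem_behead (s := i :: r) jr)).
have ik : i != k by apply: contraNneq kA => <-; rewrite rA ?mem_head.
have size_r : (size r < n)%N.
  have /card_uniqP/= <- : uniq (i :: r) by rewrite /= ir.
  by rewrite (leq_trans (max_card _))// card_ord.
have := sym_class_transfer SB IH ik tau0.
rewrite !mxE eqxx (negbTE ik) (negbTE ir).
have gap_i : u 0 i + tau <= u 0 k - (size r)%:R * tau.
  have := gap i (rA i (mem_head _ _)).
  have : (size r).+1%:R * tau <= n%:R * tau by rewrite ler_wpM2r// ler_nat.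
  by rewrite -natr1 mulrDl mul1r; lra.
move=> /(_ gap_i); congr (B _); apply/rowP => j; rewrite !mxE in_cons.
rewrite -natr1 mulrDl mul1r opprD addrA.
by case: eqVneq => // jk; case: eqVneq => //= ->.
Qed.

(** Spread a little of the modulus of coordinate [k] evenly over all
    coordinates of smaller modulus.  Since these number less than [n], what
    coordinate [k] loses in the direction [d] exceeds what it gives away,
    while every receiver gets more than [d] can add to it. *)
Lemma illuminates_swap B x d (k : 'I_n) : sym_class B -> B x ->
  x 0 k * d 0 k < 0 -> (forall i, i != k -> n%:R * `|d 0 i| < `|d 0 k|) ->
  (forall i, i != k -> x 0 i * d 0 i < 0 \/ `|x 0 i| < `|x 0 k|) ->
  illuminates_point d B x.
Proof.
move=> SB Bx xdk dk xk.
have n0 : 0 < n%:R :> R by rewrite ltr0n (leq_ltn_trans _ (ltn_ord k)).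
have dk0 : 0 < `|d 0 k|.
  by rewrite normr_gt0; apply: contraTneq xdk => ->; rewrite mulr0 ltxx.
pose A := [set i | `|x 0 i| < `|x 0 k|]%SET.
have kA : k \notin A by rewrite inE ltxx.
have [|tau tau0 tauP] := ex_pos_lower_bound (fun i => i \in A)
    (fun i => (`|x 0 k| - `|x 0 i|) / n%:R).
  by move=> i; rewrite inE => ?; rewrite divr_gt0// subr_gt0.
have Bx' : B (\row_i `|x 0 i|).
  by apply: sym_class_unconditional SB Bx _ => i; rewrite mxE normr_id.
have gap i : i \in A ->
    (\row_i `|x 0 i|) 0 i + n%:R * tau <= (\row_i `|x 0 i|) 0 k.
  by move=> /tauP; rewrite !mxE ler_pdivlMr// mulrC; lra.
have By := sym_class_spread SB Bx' kA (ltW tau0) gap.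
have An : #|A|%:R * tau < n%:R * tau.
  rewrite ltr_pM2r// ltr_nat.
  apply: (leq_trans (n := #|'I_n|)); last by rewrite card_ord.
  by apply: proper_card; apply/properP; split; [exact/subset_predT|exists k].
apply: (illuminates_toward (mu := n%:R * tau / `|d 0 k|) SB Bx By).
  by rewrite !(divr_gt0, mulr_gt0).
move=> i; rewrite !mxE; case: (eqVneq i k) => [->|ik].
  by left; split=> //; rewrite divfK ?gt_eqF//; lra.
case: ifPn => iA; last first.
  left; case: (xk i ik) => [xd|]; last by move: iA; rewrite inE => /negP.
  split=> //; rewrite ltrBlDr ltrDl !(divr_gt0, mulr_gt0)// normr_gt0.
  by apply: contraTneq xd => ->; rewrite mulr0 ltxx.
right; rewrite ltrD2l mulrAC ltr_pdivrMr// mulrAC mulrC ltr_pM2l//.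
exact: dk.
Qed.

(** Here no coordinate can be traded for another one, and [x] is compared with
    the unit vector of coordinate [j], towards which all other coordinates
    decrease at rate [M] while coordinate [j] increases at rate [1 - M]. *)
Lemma illuminates_equal_moduli B x d (j : 'I_n) (M c : R) :
  sym_class B -> B x -> 0 < M -> (forall i, `|x 0 i| = M) ->
  0 < c -> (forall i, i != j -> x 0 i * d 0 i < 0 /\ c <= `|d 0 i|) ->
  d 0 j != 0 -> M * `|d 0 j| < (1 - M) * c ->
  illuminates_point d B x.
Proof.
move=> SB Bx M0 xM c0 xd dj0 Mdj; rewrite -normr_gt0 in dj0.
pose mu := (M / c + (1 - M) / `|d 0 j|) / 2.
have mu_gap : M / c < (1 - M) / `|d 0 j|.
  by rewrite ltr_pdivrMr// mulrAC ltr_pdivlMr.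
have mu_lo : M < mu * c by rewrite -ltr_pdivrMr// /mu; lra.
have mu_hi : mu * `|d 0 j| < 1 - M by rewrite -ltr_pdivlMr// /mu; lra.
have mu0 : 0 < mu by rewrite -(pmulr_lgt0 _ c0); exact: lt_trans mu_lo.
apply: (illuminates_toward SB Bx (sym_class_unit j SB) mu0) => i.
rewrite [delta_mx _ _ _ _]mxE eqxx /= xM.
case: (eqVneq i j) => [->|ij]; first by right; rewrite /=; lra.
have [xdi cdi] := xd i ij; left; split=> //; rewrite subr_lt0//.
by apply: lt_le_trans mu_lo _; rewrite ler_wpM2l// ltW.
Qed.

(** Spread the first unit vector evenly. *)
Lemma sym_class_diag B : sym_class B -> B (\row_i n%:R^-1).
Proof.
move=> SB; have [n0|n0] := posnP n.
  have [_ _ [y /interior_subset]] : convex_body B by case: SB.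
  by congr (B _); apply/rowP => i; have := ltn_ord i; rewrite {2}n0.
pose k := Ordinal n0; pose A := ~: [set k].
have nR : n%:R != 0 :> R by rewrite pnatr_eq0 -lt0n.
have kA : k \notin A by rewrite !inE eqxx.
have gap i : i \in A ->
    (delta_mx 0 k : 'rV[R]_n) 0 i + n%:R * n%:R^-1 <=
    (delta_mx 0 k : 'rV[R]_n) 0 k.
  by rewrite !inE !mxE !eqxx /= => /negbTE ->; rewrite add0r divff.
have tau0 : 0 <= n%:R^-1 :> R by rewrite invr_ge0.
have := sym_class_spread SB (sym_class_unit k SB) kA tau0 gap.
congr (B _); apply/rowP => i; rewrite !mxE !inE !eqxx /=.
case: eqVneq => [_|ik] /=; last by rewrite add0r.
have -> : #|A| = n.-1 by rewrite cardsC1 card_ord.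
have -> : n.-1%:R = n%:R - 1 :> R by rewrite -[in RHS](prednK n0) -natr1 addrK.
by field.
Qed.

End Symmetric.

(** * The distance to the cube *)

Section CubeDistance.
Set Implicit Arguments.
Unset Strict Implicit.
Context {R : realType} {n : nat}.
Implicit Types (B : set 'rV[R]_n) (alpha : R).

Lemma cube_subset_scale B alpha : sym_class B -> 0 < alpha ->
  cube `<=` [set alpha *: x | x in B] <-> B (\row_i alpha^-1).
Proof.
move=> SB a0; have aN0 : alpha != 0 by rewrite gt_eqF.
split=> [/(_ (\row_i 1))|Ba x xcube].
  case=> [i|x Bx xE]; first by rewrite mxE lexx andbT; lra.
  suff -> : \row_i alpha^-1 = x by [].
  by rewrite -[x](scalerK aN0) xE; apply/rowP => i; rewrite !mxE mulr1.
exists (alpha^-1 *: x); last by rewrite scalerKV.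
apply: sym_class_unconditional SB Ba _ => i; rewrite !mxE normrM.
by rewrite ler_piMr// ler_norml xcube.
Qed.

Lemma cube_dist_le B alpha : sym_class B -> 1 <= alpha ->
  B (\row_i alpha^-1) -> cube_dist B <= alpha.
Proof.
move=> SB a1 Ba; apply: ge_inf; first by exists 1 => a [].
by split=> //; apply/cube_subset_scale => //; exact: lt_le_trans a1.
Qed.

(** If the distance is 1, points [alpha^-1 (1, ..., 1)] of [B] with [alpha]
    close to 1 converge to [(1, ..., 1)], and [B] is closed. *)
Lemma cube_dist_gt1P B : (0 < n)%N -> sym_class B ->
  1 < cube_dist B <-> ~ B (\row_i 1).
Proof.
move=> n0 SB; split=> [dB B1|B1].
  by have := cube_dist_le SB (lexx 1); rewrite invr1 leNgt dB => /(_ B1).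
rewrite ltNge; apply/negP => dB; apply: B1.
apply: (sym_class_closed SB) => U /nbhs_ballP[e /= e0 eU].
have [|a [a1]] := inf_adherent (E := [set alpha | 1 <= alpha /\
  cube `<=` [set alpha *: x | x in B]]) e0.
  split; last by exists 1 => a [].
  exists n%:R; split; first by rewrite ler1n.
  have n'0 : 0 < n%:R :> R by rewrite ltr0n.
  by apply/(cube_subset_scale SB n'0); exact: sym_class_diag.
have a0 := lt_le_trans ltr01 a1.
move=> /(cube_subset_scale SB a0) Ba ae.
exists (\row_i a^-1); split => //; apply: eU; split => // i j.
rewrite /ball /= !mxE.
have {ae} ae : a - 1 < e by move: ae dB; rewrite /cube_dist; lra.
have a'1 : a^-1 <= 1 by rewrite invf_le1.
rewrite ger0_norm ?subr_ge0//; apply: le_lt_trans ae.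
have -> : 1 - a^-1 = a^-1 * (a - 1) by field; rewrite gt_eqF.
by rewrite ler_piMl// subr_ge0.
Qed.

Lemma m_index_ltP B : (0 < n)%N -> (m_index B < n)%N <-> ~ B (\row_i 1).
Proof.
move=> n0.
have sumE k : (n <= k)%N ->
    (\sum_(i < n | (i < k)%N) delta_mx 0 i)%R = \row_i 1 :> 'rV[R]_n.
  move=> nk; rewrite (row_sum_delta (\row_i 1)).
  apply: eq_big => [i|i _]; first by rewrite (leq_trans (ltn_ord i)).
  by rewrite mxE scale1r.
rewrite /m_index; split=> [mn B1|B1].
  move: mn; rewrite ltnNge => /negP; apply.
  apply: (@leq_bigmax_seq _ _ _ id n) => //.
    by rewrite mem_index_iota n0 ltnS leqnn.
  by apply/asboolP; rewrite sumE.
rewrite -[ltnRHS](prednK n0) ltnS.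
apply/bigmax_leqP_seq => k _ /asboolP Bk.
rewrite -ltnS prednK// ltnNge; apply/negP => nk; apply: B1.
by rewrite -(sumE k).
Qed.

End CubeDistance.

(** * The recursive directions as sign patterns *)

(** Sign patterns are functions on [nat], with [true] for a minus sign, so that
    patterns of all lengths live in one type; a pattern of length [n] is what
    such a function does below [n], and [last_turn s p] looks at positions
    [0] to [p]. *)
Fixpoint last_turn (s : nat -> bool) (p : nat) : nat :=
  if p is q.+1 then if s p == s q then last_turn s q else p else 0%N.

Definition signed_row {R : realType} (delta : R) (n : nat) (s : nat -> bool) :
    'rV[R]_n :=
  \row_(i < n)
    ((-1) ^+ s i * (if i == last_turn s n.-1 :> nat then 1 else delta)).

Lemma last_turn_leq s p : (last_turn s p <= p)%N.
Proof. by elim: p => //= p IH; case: ifP => // _; exact: leqW. Qed.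

Lemma eq_last_turn s s' p : (forall i, (i <= p)%N -> s i = s' i) ->
  last_turn s p = last_turn s' p.
Proof.
elim: p => //= p IH ss'; rewrite !ss' ?leqnSn// IH// => i ip.
by rewrite ss'// leqW.
Qed.

Lemma last_turnP s k p : (k <= p)%N ->
  (forall i, (k <= i <= p)%N -> s i = s k) ->
  (k = 0%N \/ s k != s k.-1) -> last_turn s p = k.
Proof.
move=> + + k0; elim: p => [|p IH]; first by rewrite leqn0 => /eqP ->.
rewrite leq_eqVlt ltnS => /predU1P[{IH}kp _|kp sk] /=.
  by move: k0; rewrite kp => -[//|/= /negbTE ->].
rewrite !sk ?kp ?leqnn ?leqnSn ?leqW// eqxx IH// => i /andP[ki ip].
by rewrite sk// ki leqW.
Qed.

Section SignedRows.
Set Implicit Arguments.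
Unset Strict Implicit.
Context {R : realType} (delta : R).
Implicit Types (n : nat) (s : nat -> bool).
Local Notation signed_row := (signed_row delta).

Lemma eq_signed_row n s s' : (forall i, (i < n)%N -> s i = s' i) ->
  signed_row n s = signed_row n s'.
Proof.
move=> ss'; apply/rowP => i; rewrite !mxE ss'// (@eq_last_turn s s')// => j.
by case: n i ss' => [[]//|n i ss'] jn; apply: ss'.
Qed.

Lemma signed_rowN n s : - signed_row n s = signed_row n (fun i => ~~ s i).
Proof.
apply/rowP => i; rewrite !mxE -mulNr; congr (_ * _).
  by case: (s i); rewrite ?expr1 ?expr0 ?opprK.
suff -> p : last_turn (fun i => ~~ s i) p = last_turn s p by [].
by elim: p => //= p ->; rewrite (inj_eq negb_inj).
Qed.

Lemma normr_signed_row n s (i : 'I_n) : 0 < delta ->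
  `|signed_row n s 0 i| = if i == last_turn s n.-1 :> nat then 1 else delta.
Proof.
move=> d0; rewrite mxE normrM normrX normrN1 expr1n mul1r ger0_norm//.
by case: ifP => // _; exact: ltW.
Qed.

Lemma signed_row_neq0 n s (i : 'I_n) : 0 < delta -> signed_row n s 0 i != 0.
Proof. by move=> d0; rewrite -normr_gt0 normr_signed_row//; case: ifP. Qed.

Lemma signed_row_lt0 n s (i : 'I_n) : 0 < delta ->
  (signed_row n s 0 i < 0) = s i.
Proof.
move=> d0; rewrite mxE; set c := if _ then _ else _.
have c0 : 0 < c by rewrite /c; case: ifP.
case: (s i); first by rewrite expr1 mulN1r oppr_lt0.
by rewrite expr0 mul1r ltNge (ltW c0).
Qed.

Lemma signed_row_inj n s s' : 0 < delta ->
  signed_row n s = signed_row n s' -> forall i, (i < n)%N -> s i = s' i.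
Proof.
move=> d0 ss' i i_n.
by rewrite -(signed_row_lt0 s (Ordinal i_n) d0) ss' signed_row_lt0.
Qed.

(** The two cases are the two families of the recursion: repeating the last
    sign keeps the dominant entry, changing it makes the new entry dominant. *)
Lemma signed_row_rcons n s : signed_row n.+2 s =
  if s n.+1 == s n then row_rcons (signed_row n.+1 s) ((-1) ^+ s n.+1 * delta)
  else row_rcons (\row_(j < n.+1) ((-1) ^+ s j * delta)) ((-1) ^+ s n.+1).
Proof.
apply/rowP => i; rewrite mxE [last_turn _ _]/=; case: (s n.+1 == s n).
  rewrite [RHS]mxE; case: unliftP => [j ->|->].
    by rewrite lift_max /= mxE.
  by rewrite gtn_eqF// ltnS last_turn_leq.
rewrite [RHS]mxE; case: unliftP => [j ->|->].
  by rewrite lift_max /= mxE ltn_eqF.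
by rewrite eqxx mulr1.
Qed.

Lemma rec_dirsE n : 0 < delta ->
  rec_dirs delta n.+2 = [set signed_row n.+2 s | s in setT].
Proof.
move=> d0.
have sgE m s (j : 'I_m) : Num.sg (signed_row m s 0 j) = (-1) ^+ s j.
  rewrite mxE sgrM sgrX sgrN1; set c := if _ then _ else _.
  by rewrite (gtr0_sg (_ : 0 < c)) ?mulr1// /c; case: ifP.
rewrite /=; elim: n => [|n IH] /=.
  have row2E s : signed_row 2 s =
      if s 1%N == s 0%N then row2 ((-1) ^+ s 0%N) ((-1) ^+ s 1%N * delta)
      else row2 ((-1) ^+ s 0%N * delta) ((-1) ^+ s 1%N).
    apply/rowP => i; rewrite mxE /=; case: (s 1%N == s 0%N).
      by rewrite !mxE; case: i => -[|[]]//= ?; rewrite mulr1.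
    by rewrite !mxE; case: i => -[|[]]//= ?; rewrite mulr1.
  have row2N a b : - row2 a b = row2 (- a) (- b) :> 'rV[R]_2.
    by apply/rowP => i; rewrite !mxE; case: ifP.
  apply/seteqP; split=> [d [[[->|->]|->]|->]|_ [s _ <-]] /=; rewrite ?row2N.
  - by exists xpred0 => //; rewrite row2E /= !expr0 mul1r.
  - by exists xpredT => //; rewrite row2E /= !expr1 mulN1r.
  - by exists (fun i => i == 1%N) => //; rewrite row2E /= expr0 expr1 mul1r.
  - exists (fun i => i == 0%N) => //.
    by rewrite row2E /= expr0 expr1 mulN1r opprK.
  rewrite row2E; case: (s 0%N) (s 1%N) => -[] /=;
    rewrite ?expr0 ?expr1 ?mulN1r ?mul1r ?opprK; tauto.
rewrite IH; apply/seteqP; split.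
  move=> d [[_ [s _ <-] <-]|[_ [s _ <-] <-]] /=.
    (* [minn] extends [s] by repeating its last sign. *)
    exists (fun i => s (minn i n.+1)) => //.
    rewrite signed_row_rcons minnn (minn_idPr _)// eqxx sgE; congr row_rcons.
    by apply: eq_signed_row => i; rewrite ltnS => /minn_idPl ->.
  exists (fun i => if (i <= n.+1)%N then s i else ~~ s n.+1) => //.
  rewrite signed_row_rcons ltnn leqnn; case: eqP => [|_]; first by case: (s _).
  congr row_rcons.
    by apply/rowP => i; rewrite [LHS]mxE [RHS]mxE sgE -ltnS ltn_ord mulrC.
  by rewrite sgE; case: (s _); rewrite ?expr1 ?expr0 ?opprK.
move=> _ [s _ <-] /=.
rewrite signed_row_rcons; case: eqP => sn; [left|right].
  by exists (signed_row n.+2 s); [exists s|rewrite sgE sn].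
exists (signed_row n.+2 s); first by exists s.
rewrite sgE; congr row_rcons.
  by apply/rowP => i; rewrite [LHS]mxE [RHS]mxE sgE mulrC.
by case: (s n.+1) (s n.+2) sn => -[]//; rewrite ?expr1 ?expr0 ?opprK.
Qed.

End SignedRows.

(** * Choosing a sign pattern *)

(** The patterns of the four removed directions: the constant ones, and
    [+-(+, ..., +, -, +)], whose exceptional sign is at position [m.+1] of
    [0, ..., m.+2]. *)
Definition excluded (m : nat) (s : nat -> bool) : Prop :=
  exists b : bool, (forall i, (i < m.+3)%N -> s i = b) \/
                   (forall i, (i < m.+3)%N -> s i = (i == m.+1) (+) b).

(** [T] is the set of positions where the signs are prescribed, by [t].  Let
    [k] be the least position of [T] from which on [t] is constant on [T], and
    complete [t] by the sign [~~ t k] before [k] and [t k] after [k].  By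
    minimality the sign before [k] is not [t k], prescribed or not, so [k] is
    the last turn.  If the pattern found is [+-(+, ..., +, -, +)] then [k] is
    the last position; a free position before the penultimate one would have
    the sign [~~ t k], and a free penultimate position would make [t] constant
    on [T], so that [k] would be [0]. *)
Lemma pattern_choice m (T t : nat -> bool) :
  (exists2 i, (i < m.+3)%N & T i) ->
  exists s k, [/\ (k < m.+3)%N, T k, last_turn s m.+2 = k,
    forall i, (i < m.+3)%N -> T i -> s i = t i &
    [\/ ~ excluded m s,
        k = 0%N /\ (forall i, (i < m.+3)%N -> T i -> t i = t 0%N) |
        (forall i, (i < m.+3)%N -> T i) /\
        (exists b, forall i, (i < m.+3)%N -> t i = (i == m.+1) (+) b)]].
Proof.
move=> Tex.
pose P k := [&& (k < m.+3)%N, T k &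
  [forall j : 'I_m.+3, T j ==> (k <= j)%N ==> (t j == t k)]].
have PP k : reflect [/\ (k < m.+3)%N, T k &
    forall j, (j < m.+3)%N -> T j -> (k <= j)%N -> t j = t k] (P k).
  apply: (iffP and3P) => -[km Tk H]; split=> //.
    move=> j jm Tj kj; have /forallP/(_ (Ordinal jm)) := H.
    by rewrite /= Tj kj => /eqP.
  by apply/forallP => j; apply/implyP => Tj; apply/implyP => kj; rewrite H.
have Pex : exists k, P k.
  have [|i|k /andP[km Tk] kmax] := @ex_maxnP (fun i => (i < m.+3)%N && T i) m.+3.
  - by case: Tex => i im Ti; exists i; rewrite im.
  - by case/andP => /ltnW.
  exists k; apply/PP; split=> // j jm Tj kj; congr t; apply/eqP.
  by rewrite eqn_leq kj kmax// jm.
have [k /PP[km Tk tk] kmin] := ex_minnP Pex.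
pose s i := if T i then t i else (i < k)%N (+) t k.
have sk : s k = t k by rewrite /s Tk.
have sT i : T i -> s i = t i by rewrite /s => ->.
have kturn : k = 0%N \/ s k != s k.-1.
  case: (posnP k) => [|k0]; [by left|right].
  rewrite sk {1}/s prednK// leqnn; case: ifP => Tk'; last by case: (t k).
  apply/negP => /eqP tk'; suff /kmin : P k.-1 by rewrite leqNgt prednK ?leqnn.
  apply/PP; split=> //; first by rewrite (leq_ltn_trans (leq_pred _)).
  move=> j jm Tj; rewrite leq_eqVlt prednK// => /predU1P[<-//|kj].
  by rewrite -tk' tk.
have turnE : last_turn s m.+2 = k.
  apply: last_turnP => // i /andP[ki im]; rewrite sk /s.
  by case: ifP => Ti; [rewrite tk|rewrite ltnNge ki].
exists s, k; split=> //; first by move=> i _; exact: sT.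
have [k0|k0] := posnP k.
  by apply: Or32; rewrite -k0; split=> // i im Ti; rewrite tk ?k0.
have [|] := pselect (excluded m s); last by move=> ?; apply: Or31.
case=> b [sb|sb].
  case: kturn => [k_0|]; first by rewrite k_0 in k0.
  by rewrite !sb ?eqxx// (leq_ltn_trans (leq_pred _)).
have kE : k = m.+2.
  have [s1 s2] := (sb _ (ltnSn m.+2), sb m.+1 (ltnW (ltnSn m.+2))).
  by rewrite -turnE /= s1 s2 eqxx gtn_eqF//; case: (b).
have tkb : t k = b by rewrite -sk sb// kE gtn_eqF.
have TT i : (i < m.+3)%N -> i != m.+1 -> T i.
  move=> im im1; apply/idP/negPn/negP => Ti; have := sb i im.
  have ik : (i < k)%N.
    rewrite ltn_neqAle kE -ltnS im andbT; apply: contraNneq Ti => ->.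
    by rewrite -kE.
  by rewrite /s (negbTE Ti) ik (negbTE im1) tkb; case: (b).
have Tm : T m.+1.
  apply/idP/negPn/negP => Tm; suff /kmin : P 0%N by rewrite leqNgt k0.
  have s_b j : (j < m.+3)%N -> T j -> t j = b.
    move=> jm Tj; rewrite -sT// sb//.
    by case: eqVneq Tj Tm => // -> ->.
  by apply/PP; split=> // [|j jm Tj _]; rewrite ?TT// !s_b// TT.
have Tall i : (i < m.+3)%N -> T i.
  by move=> im; case: (eqVneq i m.+1) => [->//|]; exact: TT.
by apply: Or33; split=> //; exists b => i im; rewrite -sT ?Tall// sb.
Qed.

(** * The modified directions *)

Section ModifiedDirections.
Set Implicit Arguments.
Unset Strict Implicit.
Context {R : realType} (delta : R) (delta0 : 0 < delta).

Lemma row_head1E m : row_head1 delta m.+3 = signed_row delta m.+3 xpred0.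
Proof.
apply/rowP => i; rewrite !mxE expr0 mul1r.
by rewrite (@last_turnP _ 0%N)//; left.
Qed.

Lemma row_last1E m :
  row_last1 delta m.+3 = signed_row delta m.+3 (fun i => i == m.+1).
Proof.
apply/rowP => i; rewrite !mxE /= eqxx (gtn_eqF (ltnSn _)) /=.
case: (eqVneq (val i) m.+2) => [-> | im].
  by rewrite (gtn_eqF (ltnSn _)) expr0 mulr1.
by case: eqVneq => _; rewrite ?expr1 ?expr0 ?mulN1r ?mul1r.
Qed.

Lemma removed_dirsE m :
  [set row_head1 delta m.+3; - row_head1 delta m.+3;
       row_last1 delta m.+3; - row_last1 delta m.+3] =
  [set signed_row delta m.+3 s | s in excluded m].
Proof.
rewrite row_head1E row_last1E !signed_rowN; apply/seteqP; split=> d /=.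
  case=> [[[->|->]|->]|->]; eexists; try reflexivity.
  - by exists false; left.
  - by exists true; left.
  - by exists false; right => i _; rewrite addbF.
  - by exists true; right => i _; rewrite addbT.
case=> s [[] [sb|sb]] <-.
- by left; left; right; apply: eq_signed_row.
- by right; apply: eq_signed_row => i /sb ->; rewrite addbT.
- by do 3 left; apply: eq_signed_row.
- by left; right; apply: eq_signed_row => i /sb ->; rewrite addbF.
Qed.

Lemma modified_dirsE eta m : modified_dirs delta eta m.+3 =
  [set signed_row delta m.+3 s | s in ~` excluded m] `|`
  [set (-1) ^+ nat_of_bool b *: row_mod delta eta m.+3 | b in [set: bool]].
Proof.
rewrite /modified_dirs removed_dirsE rec_dirsE//; congr (_ `|` _).
  apply/seteqP; split=> d /=.
    by case=> -[s _ <-] ns; exists s => // es; apply: ns; exists s.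
  case=> s ns <-; split; first by exists s.
  case=> s' es' ss'; apply: ns; case: es' => b H; exists b.
  by case: H => H; [left|right] => i im;
    rewrite -(signed_row_inj delta0 ss') ?H.
apply/seteqP; split=> d /=.
  by case=> ->; [exists false|exists true] => //; rewrite ?scale1r ?scaleN1r.
by case=> -[] _ <-; rewrite ?scale1r ?scaleN1r; [right|left].
Qed.

Lemma normr_row_mod eta m b (i : 'I_m.+3) : 0 < eta ->
  `|((-1) ^+ b *: row_mod delta eta m.+3 : 'rV[R]_m.+3) 0 i| =
  if i == 0%N :> nat then 1 else if i == m.+1 :> nat then eta else delta.
Proof.
move=> eta0; rewrite !mxE normrM normrX normrN1 expr1n mul1r ger0_norm//.
by case: ifP => // _; case: ifP => // _; exact: ltW.
Qed.

Lemma row_mod_neq0 eta m b (i : 'I_m.+3) : 0 < eta ->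
  ((-1) ^+ b *: row_mod delta eta m.+3 : 'rV[R]_m.+3) 0 i != 0.
Proof.
move=> eta0; rewrite -normr_gt0 normr_row_mod//.
by case: ifP => // _; case: ifP.
Qed.

Lemma row_mod_lt0 eta m (b : bool) (i : 'I_m.+3) : 0 < eta ->
  (((-1) ^+ b *: row_mod delta eta m.+3 : 'rV[R]_m.+3) 0 i < 0) = b.
Proof.
move=> eta0; rewrite !mxE; set c := if _ then _ else _.
have c0 : 0 < c by rewrite /c; case: ifP => // _; case: ifP.
case: b; first by rewrite expr1 mulN1r oppr_lt0.
by rewrite expr0 mul1r ltNge (ltW c0).
Qed.

(** The sign patterns other than [+-(+, ..., +, -, +)] parametrize the modified
    directions, when the constant patterns are sent to the new directions. *)
Lemma counting_modified_dirs eta m :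
  (counting (modified_dirs delta eta m.+3) <= (2 ^+ m.+3 - 2)%:E :> \bar R)%E.
Proof.
pose pat b : m.+3.-tuple bool := [tuple (i == m.+1 :> nat) (+) b | i < m.+3].
pose cst b : m.+3.-tuple bool := [tuple of nseq m.+3 b].
pose F (t : m.+3.-tuple bool) : 'rV[R]_m.+3 :=
  if t == cst false then row_mod delta eta m.+3 else
  if t == cst true then - row_mod delta eta m.+3 else
  signed_row delta m.+3 (nth false t).
pose A := ~: [set pat false; pat true].
have cardA : #|A| = (2 ^ m.+3 - 2)%N.
  rewrite cardsCs finset.setCK card_tuple card_bool cards2.
  suff -> : pat false != pat true by [].
  apply/eqP => /(congr1 (fun t => tnth t ord0)).
  by rewrite !tnth_mktuple.
have DA : modified_dirs delta eta m.+3 `<=` F @` [set` A].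
  rewrite modified_dirsE => d [[s ns <-]|[b _ <-]].
    pose t := [tuple s i | i < m.+3].
    have tE i : (i < m.+3)%N -> nth false t i = s i.
      by move=> im; rewrite -(tnth_nth false t (Ordinal im)) tnth_mktuple.
    have t_cst b : t == cst b = false.
      apply/eqP => tb; apply: ns; exists b; left => i im.
      by rewrite -tE// tb nth_nseq im.
    exists t; last by rewrite /F !t_cst; apply: eq_signed_row.
    rewrite /= !inE negb_or; apply/andP.
    suff t_pat b : t != pat b by [].
    apply/eqP => tb; apply: ns; exists b; right => i im.
    by rewrite -tE// tb -(tnth_nth false _ (Ordinal im)) tnth_mktuple.
  exists (cst b); last first.
    have /negbTE ct : cst true != cst false.
      by apply/eqP => /(congr1 (fun t => tnth t ord0)); rewrite !tnth_nseq.
    by rewrite /F; case: b; rewrite ?scale1r ?scaleN1r ?ct eqxx.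
  rewrite /= !inE negb_or; apply/andP.
  suff c_pat b' : cst b != pat b' by [].
  (* The first and the penultimate sign of [pat b'] differ. *)
  apply/eqP => cp.
  have := congr1 (fun t => tnth t ord0) cp.
  have := congr1 (fun t => tnth t (inord m.+1)) cp.
  by rewrite !tnth_mktuple !tnth_nseq /= inordK// eqxx => {cp} ->; case: b'.
have cardD : (modified_dirs delta eta m.+3 #<= `I_(2 ^ m.+3 - 2))%card.
  rewrite -cardA (card_le_eqr card_II).
  apply: card_le_trans (card_image_le (F \o @enum_val _ (mem A)) setT).
  apply: subset_card_le => d /DA[t tA <-].
  by exists (enum_rank_in tA t) => //=; rewrite enum_rankK_in.
have finD : finite_set (modified_dirs delta eta m.+3).
  by apply: card_le_finite cardD _; exact: finite_II.
rewrite /counting asboolT// lee_fin -natrX -natrB ?ler_nat; last first.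
  by rewrite -{1}(expn1 2) leq_exp2l.
exact: geq_card_fset_set.
Qed.

End ModifiedDirections.

(** * Illumination *)

Section Illumination.
Set Implicit Arguments.
Unset Strict Implicit.
Context {R : realType} {m : nat}.
Local Notation n := m.+3.
Local Notation delta := (n.+1%:R^-1 : R).

(** [pattern_choice] is applied to the positions [T] of the coordinates of
    maximal modulus [M]; [t] is the pattern of the signs opposite to those of
    [x], as [true] encodes a minus sign. *)
Lemma illuminates_modified_dirs (B : set 'rV[R]_n) (eta : R) :
  sym_class B -> 1 < cube_dist B ->
  0 < eta -> eta <= delta -> eta < delta * (cube_dist B - 1) ->
  illuminates (modified_dirs delta eta n) B.
Proof.
move=> SB dB eta0 eta_delta eta_dist.
have d0 : 0 < delta by rewrite invr_gt0 ltr0n.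
have d1 : delta < 1 by rewrite invf_lt1 ?ltr0n// ltr1n.
have nd : n%:R * delta < 1 by rewrite ltr_pdivrMr ?ltr0n// mul1r ltr_nat.
split.
  move=> d; rewrite modified_dirsE// => -[[s _ <-]|[b _ <-]].
    apply/eqP => s0; have := signed_row_neq0 s (ord0 : 'I_n) d0.
    by rewrite s0 mxE eqxx.
  apply/eqP => s0; have := row_mod_neq0 d0 b (ord0 : 'I_n) eta0.
  by rewrite s0 mxE eqxx.
move=> x [clx intx].
have Bx := sym_class_closed SB clx.
pose k0 := [arg max_(k > ord0) `|x 0 k|]%O.
have xk0 i : `|x 0 i| <= `|x 0 k0|.
  by rewrite /k0; case: Order.TotalTheory.arg_maxP => // k _ /(_ i isT).
set M := `|x 0 k0| in xk0.
have M0 : 0 < M.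
  rewrite lt_neqAle normr_ge0 andbT eq_sym; apply/negP => /eqP M0.
  apply: intx; apply: (sym_class_interior SB (sym_class_diag SB)) => i.
  by rewrite (le_lt_trans (xk0 i))// M0 mxE normr_gt0 invr_eq0 pnatr_eq0.
pose T i := `|x 0 (inord i)| == M; pose t i := 0 < x 0 (inord i).
have [|s [k [kn Tk sk sT good]]] := @pattern_choice m T t.
  by exists k0 => //; rewrite /T inord_val.
pose kk : 'I_n := Ordinal kn.
have normT (i : 'I_n) : T i -> `|x 0 i| = M by rewrite /T inord_val => /eqP.
have offT (i : 'I_n) : ~~ T i -> `|x 0 i| < `|x 0 kk|.
  by rewrite (normT kk)// /T inord_val lt_neqAle => ->; rewrite xk0.
have xT (i : 'I_n) : T i -> x 0 i != 0.
  by move=> /normT xM; rewrite -normr_gt0 xM.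
have tE (i : 'I_n) : t i = (0 < x 0 i) by rewrite /t inord_val.
case: good => [ns|[k_0 tc]|[Tall [b tb]]].
- exists (signed_row delta n s).
    by rewrite modified_dirsE//; left; exists s.
  have opp (i : 'I_n) : T i -> x 0 i * signed_row delta n s 0 i < 0.
    move=> Ti; apply: mulr_lt0_opposite (xT i Ti) (signed_row_neq0 _ _ d0) _.
    by rewrite signed_row_lt0// sT// tE.
  apply: (@illuminates_swap _ _ _ _ _ kk) => //.
  + exact: opp.
  + move=> i ik; rewrite !normr_signed_row// sk eqxx.
    by rewrite (_ : (i == k :> nat) = false)//; apply: negbTE.
  + move=> i ik; have [Ti|Ti] := boolP (T i); first by left; apply: opp.
    by right; exact: offT.
- exists ((-1) ^+ (t 0%N) *: row_mod delta eta n).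
    by rewrite modified_dirsE//; right; exists (t 0%N).
  have opp (i : 'I_n) : T i ->
      x 0 i * ((-1) ^+ t 0%N *: row_mod delta eta n : 'rV[R]_n) 0 i < 0.
    move=> Ti; apply: mulr_lt0_opposite (xT i Ti) (row_mod_neq0 d0 _ _ eta0) _.
    by rewrite row_mod_lt0// -tE tc.
  apply: (@illuminates_swap _ _ _ _ _ kk) => //.
  + exact: opp.
  + move=> i ik; rewrite !normr_row_mod//= k_0 eqxx.
    have -> : (i == 0%N :> nat) = false by rewrite -k_0; apply: negbTE.
    by case: ifP => // _; apply: le_lt_trans nd; rewrite ler_pM2l ?ltr0n.
  + move=> i ik; have [Ti|Ti] := boolP (T i); first by left; apply: opp.
    by right; exact: offT.
have BM : B (\row_i M).
  apply: sym_class_unconditional SB Bx _ => i.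
  by rewrite mxE ger0_norm ?(ltW M0)// normT// Tall.
have M1 : M < 1.
  rewrite ltNge; apply/negP => M1.
  have [+ _] := cube_dist_gt1P (ltn0Sn _) SB; move=> /(_ dB); apply.
  apply: sym_class_unconditional SB BM _ => i; rewrite !mxE normr1.
  by rewrite ger0_norm// ltW.
have dM : cube_dist B <= M^-1.
  by apply: cube_dist_le => //; rewrite ?invrK// invf_ge1// ltW.
have etaM : M * eta < (1 - M) * delta.
  have : M * eta < M * (delta * (M^-1 - 1)).
    rewrite ltr_pM2l//; apply: lt_le_trans eta_dist _.
    by rewrite ler_pM2l// lerB.
  by rewrite mulrCA mulrBr divff ?gt_eqF// mulr1 [delta * _]mulrC.
exists ((-1) ^+ b *: row_mod delta eta n).
  by rewrite modified_dirsE//; right; exists b.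
pose j : 'I_n := inord m.+1.
have jE : j = m.+1 :> nat by rewrite inordK.
apply: (@illuminates_equal_moduli _ _ _ _ _ j M delta) => //.
- by move=> i; rewrite normT// Tall.
- move=> i ij.
  have im : (i == m.+1 :> nat) = false.
    by apply: contra_neqF ij => /eqP im; exact: val_inj (etrans im (esym jE)).
  split.
    apply: mulr_lt0_opposite; [by rewrite xT ?Tall|exact: row_mod_neq0|].
    by rewrite row_mod_lt0// -tE tb// im.
  by rewrite normr_row_mod// im; case: ifP => // _; exact: ltW.
- exact: row_mod_neq0.
- by rewrite normr_row_mod// jE /= eqxx.
Qed.

End Illumination.

Theorem theorem23 (R : realType) (n : nat) (hn : (3 <= n)%N) :
  (forall B : set 'rV[R]_n, sym_class B ->
     (1 < cube_dist B <-> (m_index B < n)%N)) /\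
  (exists eta : R -> R, forall B : set 'rV[R]_n,
     sym_class B -> 1 < cube_dist B ->
     let t := eta (cube_dist B - 1) in
     [/\ 0 < t,
         illuminates (modified_dirs (n.+1%:R^-1) t n) B
       & (illumination_number B <= (2 ^+ n - 2)%:E)%E]).
Proof.
case: n hn => [|[|[|m]]]// _; split=> [B SB|].
  by rewrite cube_dist_gt1P// m_index_ltP.
(* The factor 1/2 makes eta < delta (dist - 1) strict. *)
exists (fun r => m.+4%:R^-1 * Num.min 1 r / 2) => B SB dB t.
have d0 : 0 < m.+4%:R^-1 :> R by rewrite invr_gt0 ltr0n.
have r0 : 0 < cube_dist B - 1 by rewrite subr_gt0.
pose u := Num.min 1 (cube_dist B - 1).
have u0 : 0 < u by rewrite lt_min ltr01.
have u1 : u <= 1 by rewrite ge_min lexx.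
have ur : u <= cube_dist B - 1 by rewrite ge_min lexx orbT.
have t0 : 0 < t by rewrite !(mulr_gt0, divr_gt0).
have ill : illuminates (modified_dirs m.+4%:R^-1 t m.+3) B.
  apply: illuminates_modified_dirs => //; rewrite /t -/u -mulrA.
    by rewrite ler_piMr ?ltW//; lra.
  by rewrite ltr_pM2l//; lra.
split=> //; apply: le_trans (counting_modified_dirs d0 t m).
by apply: ereal_inf_lbound; exists (modified_dirs m.+4%:R^-1 t m.+3).
Qed.
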